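(* Let $1\le p,q\le\infty$ with $\frac1p+\frac1q\le1$, let $X_1,\dots,X_n,Y$ be Banach spaces and let $T:X_1\times\dots\times X_n\to Y$ be a multilinear operator. Then $T$ is $\pi$-$(p,q)$-dominated if and only if the linear functional $$\zeta_T:(X_1\otimes\dots\otimes X_n\otimes Y^*,\alpha_{q^*,p^*}^\pi)\to\mathbb K,\qquad x^1\otimes\dots\otimes x^n\otimes y^*\mapsto\langle y^*,T(x^1,\dots,x^n)\rangle$$ is bounded. In this case $D_{p,q}^\pi(T)=\|\zeta_T\|$.
   Context: All Banach spaces are over the same field $\mathbb K\in\{\mathbb R,\mathbb C\}$; $s^*$ is the conjugate exponent of $s\in[1,\infty]$; $B_X$ is the closed unit ball. $\Sigma_{X_1\dots X_n}=\{x^1\otimes\dots\otimes x^n: x^i\in X_i\}\subset X_1\otimes\dots\otimes X_n$ (algebraic tensor product). $\mathcal L(X_1,\dots,X_n)$ is the Banach space of bounded multilinear forms with the sup norm; for such a form $\varphi$, $f_\varphi$ is the restriction to $\Sigma_{X_1\dots X_n}$ of its linearization, $f_\varphi(x^1\otimes\dots\otimes x^n)=\varphi(x^1,\dots,x^n)$. For finite sequences $(a_i),(b_i)$ in $\Sigma_{X_1\dots X_n}$ and $(e_i)$ in a Banach space $E$: $\|(a_i-b_i)_{i=1}^m\|_s^{w,\pi}=\sup_{\varphi\in B_{\mathcal L(X_1,\dots,X_n)}}\big(\sum_i|f_\varphi(a_i)-f_\varphi(b_i)|^s\big)^{1/s}$ and $\|(e_i)_{i=1}^m\|_s^w=\sup_{e^*\in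 B_{E^*}}\big(\sum_i|e^*(e_i)|^s\big)^{1/s}$ (maxima over $i$ if $s=\infty$). Let $r\in[1,\infty]$ be determined by $1=\frac1r+\frac1p+\frac1q$. $T$ is $\pi$-$(p,q)$-dominated if there is $C>0$ with $$\|(\langle y_i^*,T(x_i^1,\dots,x_i^n)-T(z_i^1,\dots,z_i^n)\rangle)_{i=1}^m\|_{r^*}\le C\,\|(x_i^1\otimes\dots\otimes x_i^n-z_i^1\otimes\dots\otimes z_i^n)_{i=1}^m\|_p^{w,\pi}\,\|(y_i^* )_{i=1}^m\|_q^w$$ for all finite sequences $(x_i^1,\dots,x_i^n)_{i=1}^m,(z_i^1,\dots,z_i^n)_{i=1}^m$ in $X_1\times\dots\times X_n$ and $(y_i^* )_{i=1}^m$ in $Y^*$; $D_{p,q}^\pi(T)$ is the infimum of such $C$. For $1\le s,t\le\infty$ with $\frac1s+\frac1t\ge1$, and $\rho\in[1,\infty]$ determined by $1=\frac1\rho+\frac1{t^*}+\frac1{s^*}$, the Laprest\'e norm on $X_1\otimes\dots\otimes X_n\otimes E$ is $\alpha_{s,t}^\pi(u)=\inf\{\|(\lambda_i)\|_\rho\,\|(a_i-b_i)\|_{t^*}^{w,\pi}\,\|(e_i)\|_{s^*}^w\}$, the infimum over all representations $u=\sum_{i=1}^m\lambda_i(a_i-b_i)\otimes e_i$ with $\lambda_i\in\mathbb K$, $a_i,b_i\in\Sigma_{X_1\dots X_n}$, $e_i\in E$. Thus $\alpha_{q^*,p^*}^\pi(u)=\inf\|(\lambda_i)\|_r\|(a_i-b_i)\|_p^{w,\pi}\|(y_i^*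 )\|_q^w$ on $X_1\otimes\dots\otimes X_n\otimes Y^*$. *)

(* Defs.v *)
From HB Require Import structures.
From mathcomp Require Import all_boot all_order all_algebra.
From mathcomp Require Import generic_quotient ring_quotient.
From mathcomp Require Import complex.
From mathcomp Require Import ring lra.
From mathcomp Require Import freeg.
From mathcomp Require Import all_classical all_reals all_analysis.

Set Implicit Arguments.
Unset Strict Implicit.
Unset Printing Implicit Defensive.

Import Order.TTheory GRing.Theory Num.Theory.
Import numFieldNormedType.Exports.

Local Open Scope classical_set_scope.
Local Open Scope ring_scope.
Local Open Scope quotient_scope.

Definition multilinear (K : fieldType) (I : eqType) (X : I -> lmodType K)
    (W : lmodType K) (f : (forall i, X i) -> W) : Prop :=
  forall (i : I) (x : forall i, X i), linear (fun t : X i => f (dfwith x i t)).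

Section Tensor.
Variables (K : fieldType) (I : eqType) (X : I -> lmodType K).

Local Notation F := {freeg (forall i, X i) / K}.

(* The tensor product is the quotient of the free vector space on the tuples
   (x_i) by the subspace generated by the multilinearity relations. *)
Definition free_gen (x : forall i, X i) : F := << 1 *g x >>.

Lemma free_genZ a x : a *: free_gen x = << a *g x >>.
Proof.
apply/eqP/freeg_eqP => y.
by rewrite coeffZ !coeffU mul1r.
Qed.

Definition is_submodule : set (set F) :=
  [set S | S 0 /\ forall (a : K) u v, S u -> S v -> S (a *: u + v)].

Definition tensor_relations : set F :=
  [set d | exists i x (a : K) (t t' : X i),
     d = free_gen (dfwith x i (a *: t + t'))
         - (a *: free_gen (dfwith x i t) + free_gen (dfwith x i t'))].

Definition tensor_null : set F := smallest is_submodule tensor_relations.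

Lemma tensor_null_submodule : is_submodule tensor_null.
Proof.
split=> [S [[]]//|a u v nu nv S SP].
have [[_ Slin] _] := SP.
by apply: Slin; [exact: nu | exact: nv].
Qed.

Definition tensor_null_pred : {pred F} := fun d => `[< tensor_null d >].

Lemma tensor_null_zmod_closed : zmod_closed tensor_null_pred.
Proof.
have [n0 nlin] := tensor_null_submodule.
split=> [|u v /asboolP nu /asboolP nv]; first exact/asboolP.
apply/asboolP; rewrite addrC -scaleN1r; exact: nlin.
Qed.

HB.instance Definition _ :=
  GRing.isZmodClosed.Build F tensor_null_pred tensor_null_zmod_closed.

Definition tensor : Type := Quotient.quot tensor_null_pred.

HB.instance Definition _ := GRing.Zmodule.on tensor.

Definition tensor_pi (d : F) : tensor := \pi_(Quotient.quot tensor_null_pred) d.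

Lemma tensor_piP (u v : F) :
  tensor_pi u = tensor_pi v <-> tensor_null (u - v).
Proof.
split=> [uv|nuv].
  by apply/asboolP; move: (Quotient.idealrBE tensor_null_pred u v);
     rewrite unfold_in => ->; apply/eqP.
apply/eqP; rewrite /tensor_pi -Quotient.idealrBE unfold_in; exact/asboolP.
Qed.

Lemma tensor_pi0 : tensor_pi 0 = 0.
Proof. by rewrite /tensor_pi [LHS]raddf0. Qed.

Lemma tensor_piD : {morph tensor_pi : u v / u + v}.
Proof. by move=> u v; rewrite /tensor_pi [LHS]raddfD. Qed.

Definition tensor_scale (a : K) (u : tensor) : tensor :=
  tensor_pi (a *: repr u).

Lemma tensor_reprK (u : tensor) : tensor_pi (repr u) = u.
Proof. exact: reprK. Qed.

Lemma tensor_piZ a (d : F) : tensor_pi (a *: d) = tensor_scale a (tensor_pi d).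
Proof.
have [n0 nlin] := tensor_null_submodule.
apply/tensor_piP; rewrite -scalerBr -[_ *: _]addr0; apply: nlin => //.
by apply/tensor_piP; rewrite tensor_reprK.
Qed.

Fact tensor_scaleA a b u :
  tensor_scale a (tensor_scale b u) = tensor_scale (a * b) u.
Proof. by rewrite -[u]tensor_reprK -!tensor_piZ scalerA. Qed.
Fact tensor_scale1 : left_id 1 tensor_scale.
Proof. by move=> u; rewrite -[u]tensor_reprK -tensor_piZ scale1r. Qed.
Fact tensor_scaleDr : right_distributive tensor_scale +%R.
Proof.
move=> a u v; rewrite -[u]tensor_reprK -[v]tensor_reprK.
by rewrite -tensor_piD -!tensor_piZ scalerDr tensor_piD.
Qed.
Fact tensor_scaleDl u : {morph tensor_scale^~ u : a b / a + b}.
Proof.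
by move=> a b; rewrite -[u]tensor_reprK -!tensor_piZ scalerDl tensor_piD.
Qed.

HB.instance Definition _ := GRing.Zmodule_isLmodule.Build K tensor
  tensor_scaleA tensor_scale1 tensor_scaleDr tensor_scaleDl.

Lemma tensor_piZE a (d : F) : a *: tensor_pi d = tensor_pi (a *: d).
Proof. by rewrite tensor_piZ. Qed.

Definition pure_tensor (x : forall i, X i) : tensor := tensor_pi (free_gen x).

(* The linearization of f; it does not depend on the chosen representative,
   and is linear, as soon as f is multilinear (universal property below). *)
Definition linearization (W : lmodType K) (f : (forall i, X i) -> W) :
  tensor -> W := fun u => fglift f (repr u).

Section UniversalProperty.
Variables (W : lmodType K) (f : (forall i, X i) -> W).
Hypothesis f_multilinear : multilinear f.

Lemma fglift_linear : linear (fglift f).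
Proof.
pose L : {additive F -> W} :=
  HB.pack (fglift f) (GRing.isZmodMorphism.Build F W _ (lift_is_additive f)).
have LZ a u : L (a *: u) = a *: L u.
  rewrite -[u in RHS]freeg_sumE [a *: u]/(fgscale a u) /fgscale !raddf_sum.
  apply: eq_bigr => x _.
  by rewrite /L /= !liftU scalerA.
by move=> a u v; rewrite -[fglift f _]/(L _) raddfD LZ.
Qed.

Lemma fglift_null d : tensor_null d -> fglift f d = 0.
Proof.
have f0 : fglift f 0 = 0.
  by have := fglift_linear (-1) 0 0; rewrite scaler0 addr0 scaleN1r addNr.
move=> nd; apply: (nd [set e | fglift f e = 0]); split.
  by split=> // a u v /= u0 v0; rewrite fglift_linear u0 v0 scaler0 addr0.
move=> _ [i [x [a [t [t' ->]]]]] /=.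
rewrite -scaleN1r addrC !fglift_linear !liftU !scale1r f_multilinear.
by rewrite scaleN1r addNr.
Qed.

Lemma linearization_pi (d : F) : linearization f (tensor_pi d) = fglift f d.
Proof.
apply/eqP; rewrite -subr_eq0; apply/eqP.
have fB u v : fglift f u - fglift f v = fglift f (u - v).
  by rewrite lift_is_additive.
rewrite fB fglift_null//; apply/tensor_piP; exact: tensor_reprK.
Qed.

Lemma linearization_linear : linear (linearization f).
Proof.
move=> a u v; rewrite -[u in LHS]tensor_reprK -[v in LHS]tensor_reprK.
by rewrite tensor_piZE -tensor_piD linearization_pi fglift_linear.
Qed.

Lemma linearization_pure x : linearization f (pure_tensor x) = f x.
Proof. by rewrite linearization_pi liftU scale1r. Qed.

End UniversalProperty.

Lemma pure_tensor_multilinear : multilinear pure_tensor.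
Proof.
move=> i x a t t'; rewrite /pure_tensor tensor_piZE -tensor_piD.
apply/tensor_piP; move=> S [_]; apply; by exists i, x, a, t, t'.
Qed.

Lemma tensor_span (u : tensor) : exists s : seq (K * (forall i, X i)),
  u = \sum_(cx <- s) cx.1 *: pure_tensor cx.2.
Proof.
exists [seq (coeff x (repr u), x) | x <- dom (repr u)].
rewrite big_map -[LHS]tensor_reprK -[repr u in LHS]freeg_sumE.
elim: (dom _) => [|x r IHr].
  rewrite !big_nil; exact: tensor_pi0.
rewrite !big_cons tensor_piD IHr; congr (_ + _).
by rewrite /pure_tensor tensor_piZE free_genZ.
Qed.

Lemma linearization_unique (W : lmodType K) (g : {linear tensor -> W}) :
  g =1 linearization (g \o pure_tensor).
Proof.
have gm : multilinear (g \o pure_tensor).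
  by move=> i x a t t' /=; rewrite pure_tensor_multilinear linearP.
move=> u; have [s ->] := tensor_span u.
pose L : {linear tensor -> W} := HB.pack (linearization (g \o pure_tensor))
  (GRing.isLinear.Build _ _ _ _ _ (linearization_linear gm)).
rewrite -[RHS]/(L _) !linear_sum; apply: eq_bigr => cx _.
by rewrite !linearZ/= linearization_pure.
Qed.

End Tensor.

Section BinaryTensor.
Variables (K : fieldType) (U V : lmodType K).

Definition pair_space (b : bool) : lmodType K := if b then V else U.

Definition pair_vector (u : U) (v : V) : forall b, pair_space b :=
  fun b => match b return pair_space b with true => v | false => u end.

Definition tensor2 := tensor pair_space.

Definition pure_tensor2 (u : U) (v : V) : tensor2 :=
  pure_tensor (pair_vector u v).

Definition linearization2 (W : lmodType K) (B : U -> V -> W) : tensor2 -> W :=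
  linearization (fun w : forall b, pair_space b => B (w false) (w true)).

Section Bilinear.
Variables (W : lmodType K) (B : U -> V -> W).
Hypothesis B_linearl : forall v, linear (B^~ v).
Hypothesis B_linearr : forall u, linear (B u).

Lemma bilinear_multilinear :
  multilinear (fun w : forall b, pair_space b => B (w false) (w true)).
Proof.
by move=> [] w a t t'; rewrite !dfwithin !dfwithout//;
  [exact: B_linearr | exact: B_linearl].
Qed.

Lemma linearization2_linear : linear (linearization2 B).
Proof. exact/linearization_linear/bilinear_multilinear. Qed.

Lemma linearization2_pure u v : linearization2 B (pure_tensor2 u v) = B u v.
Proof. exact/linearization_pure/bilinear_multilinear. Qed.

End Bilinear.
End BinaryTensor.

(* The two possible scalar fields, R and C = R[i]. *)
Variant scalar_kind := RealScalars | ComplexScalars.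

Definition scalars (R : realType) (k : scalar_kind) : numFieldType :=
  match k with RealScalars => R | ComplexScalars => R[i] end.

Section Scalars.
Variables (R : realType) (k : scalar_kind).
Local Notation K := (scalars R k).

Definition real_part : K -> R :=
  match k return scalars R k -> R with
  | RealScalars => fun x => x
  | ComplexScalars => fun z => complex.Re z
  end.

Definition of_real : R -> K :=
  match k return R -> scalars R k with
  | RealScalars => fun x => x
  | ComplexScalars => fun x => x%:C%C
  end.

(* In the library the norm of a normed module over K is itself an element of
   K; rnorm is the same norm seen as a real number. *)
Definition rnorm (V : normedZmodType K) (x : V) : R := real_part `|x|.

Lemma of_realK : cancel of_real real_part.
Proof. by rewrite /of_real /real_part; case: k. Qed.

Lemma real_partK (x : K) : 0 <= x -> of_real (real_part x) = x.
Proof.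
rewrite /of_real /real_part; case: k x => //= x.
by move=> /ger0_Im x0; rewrite [RHS]complexE x0 mulr0 addr0.
Qed.

Lemma ler_of_real x y : (of_real x <= of_real y) = (x <= y).
Proof. by rewrite /of_real; case: k => //=; rewrite lecR. Qed.

Lemma of_realD x y : of_real (x + y) = of_real x + of_real y.
Proof. by rewrite /of_real; case: k => //=; rewrite rmorphD. Qed.

Lemma of_realM x y : of_real (x * y) = of_real x * of_real y.
Proof. by rewrite /of_real; case: k => //=; rewrite rmorphM. Qed.

Lemma of_real0 : of_real 0 = 0.
Proof. by rewrite /of_real; case: k. Qed.

Lemma rnormE (V : normedZmodType K) (x : V) : of_real (rnorm x) = `|x|.
Proof. exact: real_partK. Qed.

Lemma rnorm_ge0 (V : normedZmodType K) (x : V) : 0 <= rnorm x.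
Proof. by rewrite -ler_of_real of_real0 rnormE. Qed.

Lemma rnormD (V : normedZmodType K) (x y : V) :
  rnorm (x + y) <= rnorm x + rnorm y.
Proof. by rewrite -ler_of_real of_realD !rnormE ler_normD. Qed.

Lemma rnormN (V : normedZmodType K) (x : V) : rnorm (- x) = rnorm x.
Proof. by rewrite /rnorm normrN. Qed.

Lemma rnorm_eq0 (V : normedZmodType K) (x : V) : (rnorm x == 0) = (x == 0).
Proof.
by rewrite -[RHS]normr_eq0 -rnormE -of_real0 (inj_eq (can_inj of_realK)).
Qed.

Lemma rnormZ (V : normedModType K) (a : K) (x : V) :
  rnorm (a *: x) = rnorm a * rnorm x.
Proof. by apply: (can_inj of_realK); rewrite of_realM !rnormE normrZ. Qed.

Lemma rnorm0 (V : normedZmodType K) : rnorm (0 : V) = 0.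
Proof. by apply/eqP; rewrite rnorm_eq0. Qed.

Lemma rnorm1 : rnorm (1 : K^o) = 1.
Proof. by rewrite /rnorm normr1 /real_part; case: k. Qed.

Lemma rnorm_of_real (x : R) : rnorm (of_real x : K) = `|x|.
Proof.
apply: (can_inj of_realK); rewrite rnormE.
rewrite /of_real; case: k => //=.
by rewrite normc_def/= expr0n addr0 sqrtr_sqr.
Qed.

End Scalars.

Section Dual.
Variables (R : realType) (k : scalar_kind).
Local Notation K := (scalars R k).
Variable E : normedModType K.

Definition bounded_functional : {pred E -> K^o} := fun f =>
  `[< linear f /\ exists M : R, forall x, rnorm (f x) <= M * rnorm x >].

Lemma bounded_functional_submod : submod_closed bounded_functional.
Proof.
split=> [|a f g /asboolP[fl [M fM]] /asboolP[gl [N gN]]]; apply/asboolP.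
  split=> [a x y|]; first by rewrite /= scaler0 addr0.
  exists 0 => x /=; rewrite mul0r.
  by rewrite rnorm0.
have fctE x : (a *: f + g) x = a *: f x + g x by [].
split=> [b x y|].
  rewrite !fctE fl gl !scalerDr !scalerA (mulrC a b) -!addrA; congr (_ + _).
  by rewrite addrCA.
exists (rnorm a * M + N) => x; rewrite fctE (le_trans (rnormD _ _))//.
rewrite mulrDl lerD// rnormZ -mulrA ler_wpM2l// rnorm_ge0//.
Qed.

HB.instance Definition _ := GRing.isSubmodClosed.Build K (E -> K^o)
  bounded_functional bounded_functional_submod.

Record dual := Dual { dual_fun :> E -> K^o;
                      dual_funP : dual_fun \in bounded_functional }.

HB.instance Definition _ := [isSub for dual_fun].
HB.instance Definition _ := [Choice of dual by <:].
HB.instance Definition _ := [SubChoice_isSubLmodule of dual by <:].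

Lemma dual_linear (f : dual) : linear f.
Proof. by have /asboolP[] := dual_funP f. Qed.

Lemma dual_funD (f g : dual) x : (f + g) x = f x + g x.
Proof. by []. Qed.

Lemma dual_funZ a (f : dual) x : (a *: f) x = a *: f x.
Proof. by []. Qed.

Definition dual_norm (f : dual) : R :=
  sup [set rnorm (f x) | x in [set x : E | rnorm x <= 1]].

Lemma dual_fun0 (f : dual) : f 0 = 0.
Proof.
by have := dual_linear f (-1) 0 0; rewrite scaler0 addr0 scaleN1r addNr.
Qed.

Lemma dual_funM (f : dual) a x : f (a *: x) = a *: f x.
Proof. by have := dual_linear f a x 0; rewrite dual_fun0 !addr0. Qed.

Lemma dual_norm_has_sup (f : dual) :
  has_sup [set rnorm (f x) | x in [set x : E | rnorm x <= 1]].
Proof.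
split; first by exists (rnorm (f 0)), 0 => //=; rewrite rnorm0.
have /asboolP[_ [M fM]] := dual_funP f.
exists `|M| => _ [x /= x1 <-]; rewrite (le_trans (fM x))//.
rewrite (le_trans (ler_wpM2r (rnorm_ge0 _) (ler_norm _)))//.
by rewrite ler_piMr.
Qed.

Lemma dual_norm_ge0 (f : dual) : 0 <= dual_norm f.
Proof.
rewrite (le_trans (rnorm_ge0 (f 0)))//.
apply: sup_upper_bound (dual_norm_has_sup f) _ _.
by exists 0 => //=; rewrite rnorm0.
Qed.

Lemma le_dual_norm (f : dual) x : rnorm (f x) <= dual_norm f * rnorm x.
Proof.
have [->|x0] := eqVneq x 0; first by rewrite dual_fun0 !rnorm0 mulr0.
have nx0 : 0 < rnorm x by rewrite lt_neqAle rnorm_ge0 andbT eq_sym rnorm_eq0.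
have nV y : rnorm ((of_real k (rnorm x)^-1 : K) *: (y : K^o)) =
    (rnorm x)^-1 * rnorm y.
  by rewrite rnormZ rnorm_of_real ger0_norm// invr_ge0 ltW.
rewrite -ler_pdivrMr// mulrC -nV -dual_funM.
apply: sup_upper_bound (dual_norm_has_sup f) _ _; eexists; last by [].
by rewrite /= rnormZ rnorm_of_real ger0_norm ?invr_ge0 ?(ltW nx0)// mulVf// gt_eqF.
Qed.

Lemma dual_norm_le (f : dual) M : 0 <= M ->
  (forall x, rnorm (f x) <= M * rnorm x) -> dual_norm f <= M.
Proof.
move=> M0 fM; apply: sup_le_ub; first by have [] := dual_norm_has_sup f.
move=> _ [x /= x1 <-]; rewrite (le_trans (fM x))// ler_piMr//.
Qed.

Fact dual_normD (f g : dual) :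
  of_real k (dual_norm (f + g)) <=
  of_real k (dual_norm f) + of_real k (dual_norm g).
Proof.
rewrite -of_realD ler_of_real dual_norm_le ?addr_ge0 ?dual_norm_ge0// => x.
by rewrite dual_funD (le_trans (rnormD _ _))// mulrDl lerD// le_dual_norm.
Qed.

Fact dual_normZ (a : K) (f : dual) :
  of_real k (dual_norm (a *: f)) = `|a| * of_real k (dual_norm f).
Proof.
rewrite -rnormE -of_realM; congr (of_real k _).
have le_nZ b (g : dual) : dual_norm (b *: g) <= rnorm b * dual_norm g.
  rewrite dual_norm_le ?mulr_ge0 ?rnorm_ge0 ?dual_norm_ge0// => x.
  by rewrite dual_funZ rnormZ -mulrA ler_wpM2l ?rnorm_ge0 ?le_dual_norm.
apply/eqP; rewrite eq_le le_nZ /=.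
have [->|a0] := eqVneq a 0; first by rewrite rnorm0 mul0r dual_norm_ge0.
have na0 : 0 < rnorm a by rewrite lt_neqAle rnorm_ge0 andbT eq_sym rnorm_eq0.
have := ler_wpM2l (ltW na0) (le_nZ a^-1 (a *: f)).
rewrite scalerA mulVf// scale1r mulrA.
by have := rnormZ (V := K^o) a a^-1; rewrite [_ *: _]mulfV// rnorm1 => <-; rewrite mul1r.
Qed.

Fact dual_norm_eq0 (f : dual) : of_real k (dual_norm f) = 0 -> f = 0.
Proof.
move=> /(congr1 (@real_part R k)); rewrite of_realK -(of_real0 R k) of_realK => nf0.
apply: val_inj; apply/funext => x; apply/eqP.
by rewrite -(rnorm_eq0 (V := K^o)) eq_le rnorm_ge0 (le_trans (le_dual_norm f x))// nf0 mul0r.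
Qed.

HB.instance Definition _ := Lmodule_isNormed.Build K dual
  dual_normD dual_normZ dual_norm_eq0.

Lemma dual_normE (f : dual) : rnorm f = dual_norm f.
Proof. exact: of_realK. Qed.

End Dual.

Section Exponents.
Variable R : realType.

(* rho with 1 = 1/rho + 1/a + 1/b, where 1/+oo = 0 and 1/0 = +oo. *)
Definition third_exponent (a b : \bar R) : \bar R :=
  ((1 - (a^-1 + b^-1))^-1)%E.

Lemma third_exponentP (a b : \bar R) :
  (1 <= a -> 1 <= b -> a^-1 + b^-1 <= 1 ->
   1 <= third_exponent a b /\
   1 = (third_exponent a b)^-1 + a^-1 + b^-1)%E.
Proof.
have fin_inv (c : \bar R) : (1 <= c)%E -> exists2 d : R, (c^-1 = d%:E)%E & 0 <= d.
  case: c => [c||]//.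
    rewrite lee_fin => c1; have c0 : c != 0 by rewrite gt_eqF// (lt_le_trans ltr01).
    by exists c^-1; rewrite ?inver ?(negbTE c0)// invr_ge0 (le_trans ler01).
  by exists 0 => //; rewrite invey.
move=> /fin_inv[x ex x0] /fin_inv[y ey y0].
rewrite /third_exponent inveK {}ex {}ey -EFinD lee_fin => xy1.
have -> : (1 - (x + y)%:E)%E = (1 - (x + y))%:E by [].
split; last by congr EFin; ring.
rewrite inver subr_eq0; case: ifPn => [_|xy]; first exact: leey.
have d0 : 0 < 1 - (x + y) by rewrite subr_gt0 lt_neqAle eq_sym xy.
by rewrite lee_fin invf_ge1// gerBl addr_ge0.
Qed.

(* The l_s-norm of a finite family, 1 <= s <= +oo. *)
Definition lnorm (s : \bar R) (m : nat) (a : 'I_m -> R) : R :=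
  if s is r%:E then (\sum_(i < m) `|a i| `^ r) `^ r^-1
  else \big[Num.max/0]_(i < m) `|a i|.

End Exponents.

Section WeakNorm.
Variables (R : realType) (k : scalar_kind).
Local Notation K := (scalars R k).
Variable E : normedModType K.

Definition weak_norm (s : \bar R) (m : nat) (e : 'I_m -> E) : R :=
  sup [set lnorm s (fun i => rnorm (f (e i)))
      | f in [set f : dual E | rnorm f <= 1]].

End WeakNorm.

Section Domination.
Variables (R : realType) (k : scalar_kind).
Local Notation K := (scalars R k).
Variables (n : nat) (X : 'I_n -> normedModType K).
Local Notation vectors := (forall j, X j).
Local Notation tensorX := (tensor (fun j => X j : lmodType K)).
Local Notation pureX :=
  (@pure_tensor K 'I_n (fun j => X j : lmodType K)).
Local Notation linearizeX :=
  (@linearization K 'I_n (fun j => X j : lmodType K) _).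

Definition segre : set tensorX := range pureX.

Definition bounded_form (phi : vectors -> K^o) : Prop :=
  @multilinear K 'I_n (fun j => X j : lmodType K) K^o phi /\
  exists M : R, forall x, rnorm (phi x) <= M * \prod_j rnorm (x j).

(* This sup, and those defining dual_norm and the two weak norms, are over
   nonempty bounded sets, so that sup never takes its default value. *)
Definition form_norm (phi : vectors -> K^o) : R :=
  sup [set rnorm (phi x) | x in [set x : vectors | forall j, rnorm (x j) <= 1]].

(* f_phi is linearizeX phi, used on the Segre cone only. *)
Definition weak_pi_norm (s : \bar R) (m : nat) (a b : 'I_m -> tensorX) : R :=
  sup [set lnorm s (fun i => rnorm (linearizeX phi (a i) - linearizeX phi (b i)))
      | phi in [set phi | bounded_form phi /\ form_norm phi <= 1]].

Section Laprest.
Variable E : normedModType K.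

(* X_1 (x) ... (x) X_n (x) E is taken as (X_1 (x) ... (x) X_n) (x) E.  For
   n > 0, 0 is a pure tensor and every u has a representation, so that the inf
   is over a nonempty set; for n = 0 it need not be. *)
Definition laprest_norm (s t : \bar R) (u : tensor2 tensorX E) : R :=
  let s' := hoelder_conjugate s in
  let t' := hoelder_conjugate t in
  inf [set c | exists m (lam : 'I_m -> K) (a b : 'I_m -> tensorX) (e : 'I_m -> E),
    [/\ forall i, segre (a i), forall i, segre (b i),
        u = \sum_(i < m) lam i *: pure_tensor2 (a i - b i) (e i) &
        c = lnorm (third_exponent t' s') (fun i => rnorm (lam i))
            * weak_pi_norm t' a b * weak_norm s' e]].

End Laprest.

Variables (Y : normedModType K) (p q : \bar R) (T : vectors -> Y).

Definition pi_dominated_by (C : R) : Prop :=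
  forall m (x z : 'I_m -> vectors) (y : 'I_m -> dual Y),
    lnorm (hoelder_conjugate (third_exponent p q))
      (fun i => rnorm (y i (T (x i) - T (z i))))
    <= C * weak_pi_norm p (fun i => pureX (x i)) (fun i => pureX (z i))
         * weak_norm q y.

Definition pi_dominated : Prop := exists2 C : R, 0 < C & pi_dominated_by C.

Definition pi_dominated_norm : R :=
  inf [set C : R | 0 < C /\ pi_dominated_by C].

Definition zeta : tensor2 tensorX (dual Y) -> K^o :=
  linearization2 (fun (t : tensorX) (y : dual Y) => y (linearizeX T t) : K^o).

Hypothesis T_multilinear : @multilinear K 'I_n (fun j => X j : lmodType K) Y T.

Let zeta_linearl (y : dual Y) : linear (fun t => y (linearizeX T t) : K^o).
Proof. by move=> a t t'; rewrite linearization_linear// dual_linear. Qed.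

Let zeta_linearr (t : tensorX) :
  linear (fun y : dual Y => y (linearizeX T t) : K^o).
Proof. by move=> a y y'; rewrite dual_funD dual_funZ. Qed.

Lemma zeta_linear : linear zeta.
Proof. exact: linearization2_linear zeta_linearl zeta_linearr. Qed.

Lemma zeta_pure (x : vectors) (y : dual Y) :
  zeta (pure_tensor2 (pureX x) y) = y (T x).
Proof.
rewrite /zeta (linearization2_pure zeta_linearl zeta_linearr).
by rewrite linearization_pure.
Qed.

End Domination.

(* Boundedness and operator norm of a functional on V normed by N. *)
Definition bounded_wrt (R : realType) (k : scalar_kind)
    (V : lmodType (scalars R k)) (N : V -> R) (f : V -> (scalars R k)^o) : Prop :=
  exists M : R, forall u, rnorm (f u) <= M * N u.

Definition functional_norm (R : realType) (k : scalar_kind)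
    (V : lmodType (scalars R k)) (N : V -> R) (f : V -> (scalars R k)^o) : R :=
  sup [set rnorm (f u) | u in [set u | N u <= 1]].

(* Main.v *)
(** Evaluated on a representation u = sum_i lam_i (a_i - b_i) (x) y_i, zeta_T
    gives sum_i lam_i v_i with v_i = <y_i, T x_i - T z_i>, so Hoelder's
    inequality turns domination with constant C into |zeta_T u| <= C alpha(u).
    Conversely, given x, z and y, choose lam in the unit ball of l_r for which
    Hoelder's inequality is an equality, so that sum_i lam_i v_i is the l_{r*}
    norm of v: a bound for zeta_T at this single tensor is the domination
    inequality.  The equality of constants then only needs the positive
    homogeneity of the cost of a representation. *)

Require Import Defs.
From mathcomp Require Import all_boot all_order all_algebra.
From mathcomp Require Import all_classical all_reals all_analysis.

Set Implicit Arguments.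
Unset Strict Implicit.
Unset Printing Implicit Defensive.

Import Order.TTheory GRing.Theory Num.Theory.
Local Open Scope ring_scope.

(** * Hoelder's inequality for finite families and its extremal case *)

Section LNorm.
Context {R : realType}.
Implicit Types (r s t : R) (m : nat).

(** The endpoints are split off because [lnorm] is a maximum at infinity; elsewhere both exponents
    are real, as Young's inequality requires. *)
Lemma hoelder_conjugate_cases (r : \bar R) : (1 <= r)%E ->
  [\/ r = 1%E /\ hoelder_conjugate r = +oo%E,
      r = +oo%E /\ hoelder_conjugate r = 1%E |
      exists s t, [/\ r = s%:E, hoelder_conjugate r = t%:E,
        0 < s, 0 < t & s^-1 + t^-1 = 1]].
Proof.
move=> r1; have [->|rN1] := eqVneq r 1%E.
  by constructor 1; rewrite hoelder_conjugate1.
have [->|rNy] := eqVneq r +oo%E.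
  by constructor 2; rewrite hoelder_conjugatey.
constructor 3; have r0 : (0 < r)%E := lt_le_trans lte01 r1.
have := hoelder_conj_ge1 r1; have := @hoelder_conjugate_eqy R r.
have := @hoelder_conjugate_eq1 R r (lt_trans (ltNy0) r0).
rewrite gt_eqF// => /(_ isT).
case: r r0 r1 rN1 rNy => // s s0 s1 sN1 _.
case: (hoelder_conjugate s%:E) => // [t st _ t1|_ /(_ erefl) e]; last first.
  by rewrite e eqxx in sN1.
have t0 : 0 < t := lt_le_trans ltr01 t1.
exists s, t; split => //.
by move: st; rewrite !inver !gt_eqF// => -[].
Qed.

Lemma lnorm_ge0 (s : \bar R) m (a : 'I_m -> R) : 0 <= lnorm s a.
Proof.
by case: s => [s||]; [exact: powR_ge0 | exact: bigmax_ge_id..].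
Qed.

Lemma lnorm1E m (a : 'I_m -> R) : lnorm 1 a = \sum_i `|a i|.
Proof.
rewrite /lnorm/= invr1 powRr1 ?sumr_ge0//.
by apply: eq_bigr => i _; rewrite powRr1.
Qed.

Lemma le_lnormy m (a : 'I_m -> R) i : `|a i| <= lnorm +oo a.
Proof. exact: (le_bigmax _ (fun i => `|a i|)). Qed.

Lemma lnormyZ m c (a : 'I_m -> R) : 0 <= c ->
  lnorm +oo (fun i => c * a i) = c * lnorm +oo a.
Proof.
move=> c0; rewrite /lnorm/=; elim/big_rec2: _ => [|i x y _ ->].
  by rewrite mulr0.
by rewrite maxr_pMr// normrM ger0_norm.
Qed.

Lemma lnormZ p m c (a : 'I_m -> R) : (1 <= p)%E -> 0 <= c ->
  lnorm p (fun i => c * a i) = c * lnorm p a.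
Proof.
case: p => [s s1 c0||//]; last by move=> _; exact: lnormyZ.
have s0 : 0 < s := lt_le_trans ltr01 s1.
rewrite /lnorm/=; under eq_bigr do rewrite normrM powRM//.
rewrite -mulr_sumr powRM ?powR_ge0 ?sumr_ge0//.
by rewrite -powRrM mulfV ?gt_eqF// powRr1// ger0_norm.
Qed.

Lemma sum_normalized t m (a : 'I_m -> R) : 0 < t -> lnorm t%:E a != 0 ->
  \sum_i (`|a i| / lnorm t%:E a) `^ t = 1.
Proof.
move=> t0 a0; under eq_bigr do rewrite powRM ?invr_ge0 ?lnorm_ge0//.
have AE : (lnorm t%:E a) `^ t = \sum_i `|a i| `^ t.
  rewrite -powRrM mulVf ?gt_eqF// powRr1// sumr_ge0//.
rewrite -mulr_suml -AE -powRM ?invr_ge0 ?lnorm_ge0//.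
by rewrite mulfV// powR1.
Qed.

Lemma lnorm_eq0 t m (a : 'I_m -> R) : 0 < t -> lnorm t%:E a = 0 ->
  forall i, a i = 0.
Proof.
move=> t0 /powR_eq0_eq0 /eqP.
rewrite psumr_eq0 => [/allP a0 i|i _]; last exact: powR_ge0.
have /eqP/powR_eq0_eq0/eqP := a0 i (mem_index_enum i).
by rewrite normr_eq0 => /eqP.
Qed.

(** Young's inequality summed over the family: the normalizations leave 1/s + 1/t = 1 on the
    right. *)
Lemma sum_young_le1 s t m (x y : 'I_m -> R) :
  (forall i, 0 <= x i) -> (forall i, 0 <= y i) ->
  0 < s -> 0 < t -> s^-1 + t^-1 = 1 ->
  \sum_i x i `^ s = 1 -> \sum_i y i `^ t = 1 -> \sum_i x i * y i <= 1.
Proof.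
move=> x0 y0 s0 t0 st xs yt.
have -> : 1 = \sum_i (x i `^ s / s + y i `^ t / t).
  by rewrite big_split/= -2!mulr_suml xs yt !mul1r st.
by apply: ler_sum => i _; exact: conjugate_powR.
Qed.

(** At the endpoints one factor is bounded by its maximum. Otherwise both families are scaled to
    norm 1; a family of norm 0 vanishes, and with it the left-hand side. *)
Lemma lnorm_hoelder (r : \bar R) m (a b : 'I_m -> R) : (1 <= r)%E ->
  \sum_i `|a i| * `|b i| <= lnorm r a * lnorm (hoelder_conjugate r) b.
Proof.
move=> /hoelder_conjugate_cases[[-> ->]|[-> ->]|[s [t [-> -> s0 t0 st]]]].
- by rewrite lnorm1E mulr_suml ler_sum// => i _; rewrite ler_wpM2l// le_lnormy.
- by rewrite lnorm1E mulr_sumr ler_sum// => i _; rewrite ler_wpM2r// le_lnormy.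
have [a0|a0] := eqVneq (lnorm s%:E a) 0.
  rewrite a0 mul0r big1// => i _.
  by rewrite (lnorm_eq0 s0 a0) normr0 mul0r.
have [b0|b0] := eqVneq (lnorm t%:E b) 0.
  rewrite b0 mulr0 big1// => i _.
  by rewrite (lnorm_eq0 t0 b0) normr0 mulr0.
have A0 : 0 < lnorm s%:E a by rewrite lt0r a0 lnorm_ge0.
have B0 : 0 < lnorm t%:E b by rewrite lt0r b0 lnorm_ge0.
have := sum_young_le1 (fun i => divr_ge0 (normr_ge0 (a i)) (ltW A0))
  (fun i => divr_ge0 (normr_ge0 (b i)) (ltW B0)) s0 t0 st
  (sum_normalized s0 a0) (sum_normalized t0 b0).
under eq_bigr do rewrite mulrACA -invfM.
by rewrite -mulr_suml (ler_pdivrMr _ _ (mulr_gt0 A0 B0)) mul1r; exact.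
Qed.

Lemma lnorm_extremal (r : \bar R) m (v : 'I_m -> R) : (1 <= r)%E ->
  exists l : 'I_m -> R, [/\ forall i, 0 <= l i, lnorm r l <= 1 &
    \sum_i l i * `|v i| = lnorm (hoelder_conjugate r) v].
Proof.
move=> /hoelder_conjugate_cases[[-> ->]|[-> ->]|[s [t [-> -> s0 t0 st]]]].
(* For r = 1 all the mass goes to an index where |v| is largest; the empty family has no such index,
   but its norm is 0. *)
- case: m v => [v|m v].
    by exists (fun=> 0); split=> //; rewrite ?lnorm1E /lnorm !big_ord0.
  have [j _ vj] : {j | j \in 'I_m.+1 & lnorm +oo v = `|v j|}.
    by apply: (eq_bigmax ord0) => // i _; exact: normr_ge0.
  exists (fun i => (i == j)%:R); split => [i||].
  + exact: ler0n.
  + by rewrite lnorm1E (bigD1 j)//= eqxx normr1 big1 ?addr0// => i /negbTE->;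
      rewrite normr0.
  + by rewrite vj (bigD1 j)//= eqxx mul1r big1 ?addr0// => i /negbTE->;
      rewrite mul0r.
- exists (fun=> 1); split=> //; first by apply: bigmax_le => // i _; rewrite normr1.
  by rewrite lnorm1E; apply: eq_bigr => i _; rewrite mul1r.
have [v0|v0] := eqVneq (lnorm t%:E v) 0.
  exists (fun=> 0); split=> //.
    rewrite /lnorm/= big1 ?powR0 ?invr_eq0 ?gt_eqF// => i _.
    by rewrite normr0 powR0// gt_eqF.
  by rewrite v0 big1// => i _; rewrite mul0r.
have V0 : 0 < lnorm t%:E v by rewrite lt0r v0 lnorm_ge0.
have w0 i : 0 <= `|v i| / lnorm t%:E v by rewrite divr_ge0// ltW.
(* Equality case of Young's inequality: since (t - 1) s = t, the s-th powers sum to 1, and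
   multiplying by |v_i| gives t-th powers times the norm of v. *)
exists (fun i => (`|v i| / lnorm t%:E v) `^ (t - 1)); split => [i||].
- exact: powR_ge0.
- have e : (t - 1) * s = t.
    have : (s^-1 + t^-1) * (s * t) = s * t by rewrite st mul1r.
    rewrite mulrDl mulKf ?gt_eqF// (mulrC s) mulKf ?gt_eqF//.
    by rewrite mulrBl mul1r => <-; rewrite addrK.
  rewrite {1}/lnorm; under eq_bigr do rewrite ger0_norm ?powR_ge0// -powRrM e.
  by rewrite sum_normalized// powR1.
- transitivity ((\sum_i (`|v i| / lnorm t%:E v) `^ t) * lnorm t%:E v).
    rewrite mulr_suml; apply: eq_bigr => i _.
    rewrite -(@mulr_powRB1 _ _ t)// mulrAC divfK ?gt_eqF//.
    by rewrite mulrC.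
  by rewrite sum_normalized// mul1r.
Qed.

End LNorm.

(** On an empty or unbounded set [sup] takes its default value 0, which satisfies the bound too. *)
Lemma sup_ge0 (R : realType) (A : set R) :
  (forall x, A x -> 0 <= x) -> 0 <= sup A.
Proof.
move=> A0; have [supA|/sup_out->//] := pselect (has_sup A).
by have [x Ax] := supA.1; rewrite (le_trans (A0 _ Ax))// sup_upper_bound.
Qed.

(** * Absolute values and phases of scalars *)

Section ScalarPhase.
Variables (R : realType) (k : scalar_kind).
Local Notation K := (scalars R k).

Lemma rnormM (a b : K^o) : rnorm (a * b : K^o) = rnorm a * rnorm b.
Proof. exact: (rnormZ a b). Qed.

Lemma of_real_sum m (f : 'I_m -> R) :
  of_real k (\sum_i f i) = \sum_i of_real k (f i).
Proof.
by elim/big_rec2: _ => [|i y x _ <-]; rewrite ?of_real0// of_realD.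
Qed.

Lemma rnorm_sum m (f : 'I_m -> K^o) : rnorm (\sum_i f i) <= \sum_i rnorm (f i).
Proof.
elim/big_rec2: _ => [|i y x _ xy]; first by rewrite rnorm0.
by rewrite (le_trans (rnormD _ _))// lerD2l.
Qed.

(** For nonzero v, w = |v| / v serves over both scalar fields; it will turn each term of a sum into
    its absolute value. *)
Lemma phase (v : K^o) :
  exists w : K^o, rnorm w = 1 /\ w * v = of_real k (rnorm v).
Proof.
have [->|v0] := eqVneq v 0.
  by exists 1; rewrite rnorm1 mulr0 rnorm0 of_real0.
have nv0 : rnorm v != 0 by rewrite rnorm_eq0.
exists (of_real k (rnorm v) * v^-1 : K); split; last by rewrite mulfVK.
apply: (mulIf nv0); rewrite -rnormM mulfVK// mul1r.
by rewrite (rnorm_of_real k (rnorm v)) ger0_norm// rnorm_ge0.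
Qed.

End ScalarPhase.

(** * Linearity and elementary tensors *)

Section LinearMaps.
Variable K : fieldType.

(** Stated for the bare predicate [linear], the form in which linearity of [zeta] and of
    [pure_tensor2] in its left factor is available. *)
Lemma linear_lincomb (U V : lmodType K) (f : U -> V) : linear f ->
  forall I (r : seq I) (c : I -> K) (u : I -> U),
  f (\sum_(i <- r) c i *: u i) = \sum_(i <- r) c i *: f (u i).
Proof.
move=> fl I r c u; elim/big_rec2: _ => [|i y x _ <-]; last exact: fl.
by have := fl (-1) 0 0; rewrite scaler0 addr0 scaleN1r addNr.
Qed.

Lemma linear_opp_add (U V : lmodType K) (f : U -> V) : linear f ->
  {morph f : u v / u - v}.
Proof.
by move=> fl u v; rewrite addrC -scaleN1r fl scaleN1r addrC.
Qed.

Lemma pure_tensor2_linearl (U V : lmodType K) (v : V) :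
  linear ((@pure_tensor2 K U V)^~ v).
Proof.
move=> a t t'.
(* Multilinearity speaks of updates of one coordinate, so the pair is written as an update at
   [false]. *)
have E (s : U) : pair_vector s v =
      dfwith (pair_vector 0 v) false (s : pair_space U V false).
  by apply/functional_extensionality_dep => -[];
    rewrite ?dfwithin ?dfwithout.
by rewrite /pure_tensor2 (E (a *: t + t')) (E t) (E t') pure_tensor_multilinear.
Qed.

Lemma pure_tensor_pair (U V : lmodType K) (w : forall b, pair_space U V b) :
  pure_tensor w = pure_tensor2 (w false) (w true).
Proof.
by congr pure_tensor; apply/functional_extensionality_dep => -[].
Qed.

End LinearMaps.

(** * Representations of a tensor and their cost *)

Section Zeta.
Variables (R : realType) (k : scalar_kind) (n : nat).
Local Notation K := (scalars R k).
Variables (X : 'I_n -> normedModType K) (Y : normedModType K).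
Local Notation vectors := (forall j, X j).
Local Notation tensorX := (tensor (fun j => X j : lmodType K)).
Local Notation pureX :=
  (@pure_tensor K 'I_n (fun j => X j : lmodType K)).

Lemma weak_norm_ge0 (E : normedModType K) (s : \bar R) m (e : 'I_m -> E) :
  0 <= weak_norm s e.
Proof. by apply: sup_ge0 => _ [f _ <-]; exact: lnorm_ge0. Qed.

Lemma weak_pi_norm_ge0 (s : \bar R) m (a b : 'I_m -> tensorX) :
  0 <= weak_pi_norm s a b.
Proof. by apply: sup_ge0 => _ [f _ <-]; exact: lnorm_ge0. Qed.

Variables (p q : \bar R) (T : vectors -> Y).
Hypothesis T_multilinear : @multilinear K 'I_n (fun j => X j : lmodType K) Y T.

(** Indexed by tuples of vectors instead of points of the Segre cone, to match the data of the
    domination inequality. *)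
Definition laprest_sum m (lam : 'I_m -> K) (x z : 'I_m -> vectors)
    (y : 'I_m -> dual Y) : tensor2 tensorX (dual Y) :=
  \sum_i lam i *: pure_tensor2 (pureX (x i) - pureX (z i)) (y i).

Definition laprest_cost m (lam : 'I_m -> K) (x z : 'I_m -> vectors)
    (y : 'I_m -> dual Y) : R :=
  lnorm (third_exponent p q) (fun i => rnorm (lam i : K^o)) *
  weak_pi_norm p (fun i => pureX (x i)) (fun i => pureX (z i)) *
  weak_norm q y.

Local Notation alpha :=
  (@laprest_norm R k n X (dual Y) (hoelder_conjugate q) (hoelder_conjugate p)).

Lemma laprest_cost_ge0 m (lam : 'I_m -> K) x z y : 0 <= laprest_cost lam x z y.
Proof.
by rewrite !mulr_ge0// ?lnorm_ge0 ?weak_norm_ge0 ?weak_pi_norm_ge0.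
Qed.

Lemma segre_family m (a : 'I_m -> tensorX) : (forall i, segre (a i)) ->
  exists x : 'I_m -> vectors, a = (fun i => pureX (x i)).
Proof.
move=> sa; have /choice[x xa] : forall i, exists x, pureX x = a i.
  by move=> i; have [x _ xa] := sa i; exists x.
by exists x; apply/funext => i; rewrite xa.
Qed.

(** Double conjugation gives back [p] and [q], and points of the Segre cone are lifted to tuples by
    choice. *)
Lemma laprest_normE u : alpha u =
  inf [set c | exists m (lam : 'I_m -> K) x z y,
    u = laprest_sum lam x z y /\ c = laprest_cost lam x z y]%classic.
Proof.
rewrite /laprest_norm !hoelder_conjugateK; congr (inf _).
apply/seteqP; split=> c /= [m [lam]].
  move=> [a [b [e [sa sb -> ->]]]].
  have [x ax] := segre_family sa; have [z bz] := segre_family sb.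
  by exists m, lam, x, z, e; rewrite ax bz.
move=> [x [z [y [-> ->]]]].
exists m, lam, (fun i => pureX (x i)), (fun i => pureX (z i)), y.
by split=> // i; [exists (x i) | exists (z i)].
Qed.

Lemma zeta_laprest_sum m (lam : 'I_m -> K) x z (y : 'I_m -> dual Y) :
  zeta T (laprest_sum lam x z y) =
  \sum_i (lam i : K^o) * y i (T (x i) - T (z i)).
Proof.
have zl := zeta_linear T_multilinear.
rewrite (linear_lincomb zl); apply: eq_bigr => i _; congr (_ *: _).
rewrite (linear_opp_add (@pure_tensor2_linearl _ _ _ (y i))).
rewrite (linear_opp_add zl) !zeta_pure//.
by rewrite (linear_opp_add (dual_linear (y i))).
Qed.

Hypothesis n_gt0 : (0 < n)%N.

(** As n > 0 there is a coordinate to be linear in; the scalar -1 and zero vectors there write this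
    tensor as minus itself plus itself. *)
Lemma pure_tensor0 : pureX (fun=> 0) = 0.
Proof.
pose i := Ordinal n_gt0.
have := @pure_tensor_multilinear K 'I_n (fun j => X j : lmodType K) i (fun=> 0)
  (-1) 0 0.
have -> : dfwith (fun=> 0) i (0 : X i) = (fun=> 0).
  apply/functional_extensionality_dep => j.
  by case: dfwithP.
have -> : dfwith (fun=> 0) i (-1 *: 0 + 0 : X i) = (fun=> 0).
  rewrite scaler0 addr0; apply/functional_extensionality_dep => j.
  by case: dfwithP.
by rewrite scaleN1r addNr.
Qed.

(** Makes the infimum defining [alpha] run over a nonempty set. Each pure tensor is a difference of
    Segre points because 0 is one of them. *)
Lemma laprest_sum_ex (u : tensor2 tensorX (dual Y)) :
  exists m (lam : 'I_m -> K) x z y, u = laprest_sum lam x z y.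
Proof.
pose S u := exists s : seq (K * vectors * dual Y),
  u = \sum_(t <- s) t.1.1 *: pure_tensor2 (pureX t.1.2) t.2.
have SD v w : S v -> S w -> S (v + w).
  by move=> [s ->] [t ->]; exists (s ++ t); rewrite big_cat.
have S0 : S 0 by exists [::]; rewrite big_nil.
suff [s ->] : S u.
  pose t := tnth (in_tuple s).
  exists (size s), (fun i => (t i).1.1), (fun i => (t i).1.2), (fun _ _ => 0),
    (fun i => (t i).2).
  by rewrite big_tnth; apply: eq_bigr => i _; rewrite pure_tensor0 subr0.
(* Spanning is used twice: for the outer product, then for the left factor of each term. *)
have [s ->] := tensor_span u; elim: s => [|[c w] s IHs].
  by rewrite big_nil.
rewrite big_cons; apply: SD => //=.
rewrite pure_tensor_pair; move: (w true) => y.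
have [r ->] := tensor_span (w false).
rewrite (linear_lincomb (@pure_tensor2_linearl _ _ _ y)) scaler_sumr.
exists [seq (c * t.1, t.2, y) | t <- r]; rewrite big_map.
by apply: eq_bigr => t _; rewrite scalerA.
Qed.

Hypotheses (p_ge1 : (1 <= p)%E) (q_ge1 : (1 <= q)%E)
  (pq_le1 : (p^-1 + q^-1 <= 1)%E).

Let r_ge1 : (1 <= third_exponent p q)%E.
Proof. by have [] := third_exponentP p_ge1 q_ge1 pq_le1. Qed.

(** * Domination constants as bounds for [zeta] *)

Lemma laprest_norm_le_cost m (lam : 'I_m -> K) x z y :
  alpha (laprest_sum lam x z y) <= laprest_cost lam x z y.
Proof.
rewrite laprest_normE; apply: ge_inf; last by exists m, lam, x, z, y.
by exists 0 => _ [? [? [? [? [? [_ ->]]]]]]; exact: laprest_cost_ge0.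
Qed.

Lemma laprest_norm_ge0 u : 0 <= alpha u.
Proof.
rewrite laprest_normE; apply: lb_le_inf.
  have [m [lam [x [z [y uE]]]]] := laprest_sum_ex u.
  by exists (laprest_cost lam x z y), m, lam, x, z, y.
by move=> _ [? [? [? [? [? [_ ->]]]]]]; exact: laprest_cost_ge0.
Qed.

Lemma zeta_le_cost C m (lam : 'I_m -> K) x z y : pi_dominated_by p q T C ->
  rnorm (zeta T (laprest_sum lam x z y)) <= C * laprest_cost lam x z y.
Proof.
move=> TC; rewrite zeta_laprest_sum (le_trans (rnorm_sum _))//.
under eq_bigr do rewrite rnormM.
have normE (a : K^o) : rnorm a = `|rnorm a| by rewrite ger0_norm ?rnorm_ge0.
under eq_bigr do rewrite normE [X in _ * X]normE.
rewrite (le_trans (lnorm_hoelder _ _ r_ge1))// /laprest_cost -!mulrA mulrCA.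
by rewrite ler_wpM2l ?lnorm_ge0// mulrA TC.
Qed.

Lemma zeta_le_laprest_norm C u : 0 < C -> pi_dominated_by p q T C ->
  rnorm (zeta T u) <= C * alpha u.
Proof.
(* After division by [C] it remains to bound every cost from below. *)
move=> C0 TC; rewrite mulrC -ler_pdivrMr// laprest_normE; apply: lb_le_inf.
  have [m [lam [x [z [y uE]]]]] := laprest_sum_ex u.
  by exists (laprest_cost lam x z y), m, lam, x, z, y.
move=> _ [m [lam [x [z [y [-> ->]]]]]].
by rewrite ler_pdivrMr// mulrC zeta_le_cost.
Qed.

Lemma pi_dominated_by_cost M : 0 <= M ->
  (forall m (lam : 'I_m -> K) x z y,
    rnorm (zeta T (laprest_sum lam x z y)) <= M * laprest_cost lam x z y) ->
  pi_dominated_by p q T M.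
Proof.
move=> M0 zetaM m x z y; set v := fun i => rnorm _.
have [l [l0 l1 lv]] := lnorm_extremal v r_ge1.
have /choice[w wP] := fun i => phase (y i (T (x i) - T (z i))).
(* The modulus [l i] is extremal for Hoelder's inequality and the phase [w i] makes each term
   nonnegative. *)
pose lam i : K := of_real k (l i) * w i.
have lamE : (fun i => rnorm (lam i : K^o)) = l.
  apply/funext => i; rewrite rnormM (rnorm_of_real k (l i)) ger0_norm//.
  by have [-> _] := wP i; rewrite mulr1.
have := zetaM _ lam x z y; rewrite zeta_laprest_sum.
have -> : \sum_i (lam i : K^o) * y i (T (x i) - T (z i)) =
    of_real k (lnorm (hoelder_conjugate (third_exponent p q)) v).
  rewrite -lv of_real_sum; apply: eq_bigr => i _.
  have [_ wy] := wP i; rewrite -mulrA wy of_realM.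
  by rewrite [`|v i|]ger0_norm// rnorm_ge0.
rewrite (rnorm_of_real k) ger0_norm ?lnorm_ge0// => /le_trans; apply.
rewrite /laprest_cost lamE -!mulrA ler_wpM2l//.
by rewrite ler_piMl// mulr_ge0 ?weak_norm_ge0 ?weak_pi_norm_ge0.
Qed.

(** * Homogeneity, the equivalence and the equality of constants *)

Lemma laprest_cost_scale m c (lam : 'I_m -> K) x z y : 0 <= c ->
  laprest_cost (fun i => of_real k c * lam i) x z y = c * laprest_cost lam x z y.
Proof.
move=> c0; rewrite /laprest_cost !mulrA -lnormZ//.
congr (lnorm _ _ * _ * _); apply/funext => i.
by rewrite rnormM (rnorm_of_real k) ger0_norm.
Qed.

Lemma zeta_laprest_sum_scale m c (lam : 'I_m -> K) x z y : 0 <= c ->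
  rnorm (zeta T (laprest_sum (fun i => of_real k c * lam i) x z y)) =
  c * rnorm (zeta T (laprest_sum lam x z y)).
Proof.
move=> c0; rewrite !zeta_laprest_sum.
under eq_bigr do rewrite -mulrA.
by rewrite -mulr_sumr rnormM (rnorm_of_real k) ger0_norm.
Qed.

(* The empty representation of 0 has cost 0, being 0 times itself: this avoids
   evaluating the l_r-norm of the empty family. *)
Lemma laprest_norm0_le0 : alpha 0 <= 0.
Proof.
pose lam (i : 'I_0) : K := 0; pose x (i : 'I_0) : vectors := fun=> 0.
pose y (i : 'I_0) : dual Y := 0.
have -> : 0 = laprest_sum lam x x y by rewrite /laprest_sum big_ord0.
rewrite (le_trans (laprest_norm_le_cost _ _ _ _))//.
have -> : lam = (fun i => of_real k 0 * lam i) by apply/funext => -[].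
by rewrite laprest_cost_scale// mul0r.
Qed.

Lemma zeta_bounded_dominated : bounded_wrt alpha (zeta T) <-> pi_dominated p q T.
Proof.
split=> [[M zM]|[C C0 TC]]; last first.
  by exists C => u; exact: zeta_le_laprest_norm.
(* Domination asks for a positive constant, while [M] has no sign. *)
exists (`|M| + 1); first by rewrite ltr_wpDl.
apply: pi_dominated_by_cost => [|m lam x z y]; first by rewrite addr_ge0.
rewrite (le_trans (zM _))//.
apply: le_trans (ler_wpM2r (laprest_norm_ge0 _) (_ : M <= `|M| + 1)) _.
  by rewrite (le_trans (ler_norm M))// lerDl.
by rewrite ler_wpM2l ?addr_ge0// laprest_norm_le_cost.
Qed.

Lemma pi_dominated_normE : pi_dominated p q T ->
  pi_dominated_norm p q T = functional_norm alpha (zeta T).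
Proof.
move=> [C C0 TC]; apply/eqP; rewrite eq_le; apply/andP; split; last first.
  (* Every domination constant bounds [zeta] on the unit ball of [alpha]. *)
  apply: lb_le_inf; first by exists C.
  move=> D [D0 TD]; apply: sup_le_ub.
    exists (rnorm (zeta T 0)), 0 => //=.
    by rewrite (le_trans laprest_norm0_le0).
  move=> _ [u /= u1 <-]; rewrite (le_trans (zeta_le_laprest_norm _ D0 TD))//.
  by rewrite ler_piMr// ltW.
set S := functional_norm _ _.
(* The constant [C] bounds the set, so [S] is a genuine supremum. *)
have S_ub u : alpha u <= 1 -> rnorm (zeta T u) <= S.
  move=> u1; apply: sup_upper_bound; last by exists u.
  split; first by exists (rnorm (zeta T u)), u.
  exists C => _ [v /= v1 <-]; rewrite (le_trans (zeta_le_laprest_norm _ C0 TC))//.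
  by rewrite ler_piMr// ltW.
have S0 : 0 <= S by apply: sup_ge0 => _ [u _ <-]; exact: rnorm_ge0.
(* [S] may be 0, so the admissible constant is S + e. *)
apply/ler_addgt0Pr => e e0; apply: ge_inf; first by exists 0 => D [/ltW].
split; first by rewrite ltr_wpDl.
apply: pi_dominated_by_cost => [|m lam x z y]; first by rewrite addr_ge0// ltW.
rewrite (@le_trans _ _ (S * laprest_cost lam x z y))//; last first.
  by rewrite ler_wpM2r ?laprest_cost_ge0// lerDl ltW.
set c := laprest_cost _ _ _ _.
have c0 : 0 <= c by exact: laprest_cost_ge0.
(* The cost c may be 0: dividing the coefficients by c + d instead gives a representation of cost at
   most 1. *)
suff H d : 0 < d -> rnorm (zeta T (laprest_sum lam x z y)) <= S * (c + d).
  apply/ler_addgt0Pr => f f0.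
  (* The choice d = f / (S + 1) gives S d <= f, also when S = 0. *)
  have S1 : 0 < S + 1 by rewrite ltr_wpDl.
  rewrite (le_trans (H (f / (S + 1)) _)) ?divr_gt0// mulrDr lerD2l.
  by rewrite mulrCA ler_piMr ?(ltW f0)// ler_pdivrMr// mul1r lerDl.
move=> d0; have cd : 0 < c + d by rewrite ltr_wpDl.
have cdV : 0 <= (c + d)^-1 by rewrite invr_ge0 ltW.
rewrite -ler_pdivrMr// mulrC -zeta_laprest_sum_scale//.
apply: S_ub; rewrite (le_trans (laprest_norm_le_cost _ _ _ _))//.
rewrite laprest_cost_scale// mulrC ler_pdivrMr// mul1r.
by rewrite lerDl ltW.
Qed.

End Zeta.

Theorem proposition3p2 (R : realType) (k : scalar_kind) (n : nat)
    (X : 'I_n -> completeNormedModType (scalars R k))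
    (Y : completeNormedModType (scalars R k))
    (p q : \bar R) (T : (forall j, X j) -> Y)
    (n_gt0 : (0 < n)%N)
    (p_ge1 : (1 <= p)%E) (q_ge1 : (1 <= q)%E) (pq_le1 : (p^-1 + q^-1 <= 1)%E)
    (T_multilinear : multilinear T) :
  let alpha :=
    laprest_norm (hoelder_conjugate q) (hoelder_conjugate p) in
  (pi_dominated p q T <-> bounded_wrt alpha (zeta T)) /\
  (pi_dominated p q T -> pi_dominated_norm p q T = functional_norm alpha (zeta T)).
Proof.
split; last exact: pi_dominated_normE.
by apply: iff_sym; exact: zeta_bounded_dominated.
Qed.
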